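(* Let $p$ be a prime and let $S$ be a finite $p$-group. The constructions $\mathcal F\mapsto\mathcal S(\mathcal F)$ and $\mathcal S\mapsto\mathcal F(\mathcal S)$ are mutually inverse isomorphisms between the partially ordered sets $\mathrm{Fus}(S)$ and $\mathrm{Sys}(S)$.
   Context: $\mathrm{Hom}_S(P,Q)$ is the set of homomorphisms $P\to Q$ induced by conjugation with an element of $S$; $\mathrm{Inj}(P,Q)$ is the set of injective homomorphisms $P\to Q$. A fusion system on $S$ is a category $\mathcal F$ whose objects are the subgroups of $S$, with composition the usual composition of maps, such that: (i) $\mathrm{Hom}_S(P,Q)\subseteq\mathrm{Hom}_{\mathcal F}(P,Q)\subseteq\mathrm{Inj}(P,Q)$ for all $P,Q\le S$; (ii) if $\phi\in\mathrm{Hom}_{\mathcal F}(P,Q)$ then the resulting isomorphism $P\to\phi(P)$ and its inverse are morphisms in $\mathcal F$. $\mathrm{Fus}(S)$ is the set of fusion systems on $S$, partially ordered by the subcategory relation. $\Delta_{S,S}$ is the set of subgroups $\Delta(U,\alpha,V)=\{(\alpha(v),v)\mid v\in V\}$ of $S\times S$ with $U,V\le S$, $\alpha\colon V\to U$ an isomorphism; $\Delta(S)=\{(s,s)\mid s\in S\}$. For $L,M\le S\times S$: $L*M=\{(g,k)\mid\exists h\in S:(g,h)\in L,(h,k)\in M\}$ and $L^\circ=\{(h,g)\mid(g,h)\in L\}$. $\mathrm{Sys}(S)$ is the set, ordered by inclusion, of subsets $\mathcal S\subseteq\Delta_{S,S}$ that (i) are closed under $S\times S$-conjugation, (ii) are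 closed under taking subgroups, (iii) are closed under $*$, (iv) contain $\Delta(S)$, (v) satisfy $\{L^\circ\mid L\in\mathcal S\}=\mathcal S$. For $\mathcal F\in\mathrm{Fus}(S)$: $\mathcal S(\mathcal F)=\{\Delta(\phi(P),\phi,P)\mid P\le S,\ \phi\in\mathrm{Hom}_{\mathcal F}(P,S)\}$. For $\mathcal S\in\mathrm{Sys}(S)$: $\mathcal F(\mathcal S)$ is the category with objects the subgroups of $S$, $\mathrm{Hom}_{\mathcal F(\mathcal S)}(P,Q)=\{\iota\circ\phi\mid\Delta(\phi(P),\phi,P)\in\mathcal S,\ \phi(P)\le Q\}$ with $\iota\colon\phi(P)\to Q$ the inclusion, and the usual composition of maps. *)

(* Defs.v *)
From mathcomp Require Import all_boot all_fingroup.

Set Implicit Arguments.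
Unset Strict Implicit.
Unset Printing Implicit Defensive.

Import GroupScope.

(* The group S is a whole [finGroupType], so that [{group S}] is the type of
   all its subgroups and S itself, as a subgroup, is [[set: S]%G]. *)

Section Maps.
Variable S : finGroupType.
Implicit Types P Q R U V : {group S}.

(* Arbitrary maps between the underlying sets of two subgroups.  Finite
   functions between subgroup types are compared extensionally by [=], and
   maps with different codomains have different types. *)
Definition gmap P Q := {ffun [subg P] -> [subg Q]}.

Definition gid P : gmap P P := [ffun x => x].

Definition gcomp P Q R (g : gmap Q R) (f : gmap P Q) : gmap P R :=
  [ffun x => g (f x)].

(* The inclusion map; only meaningful when [P \subset Q], since [subg Q]
   sends elements outside Q to 1. *)
Definition incl P Q : gmap P Q := [ffun x => subg Q (sgval x)].

Definition gimage P Q (f : gmap P Q) : {set S} :=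
  [set sgval (f x) | x : [subg P]].

Definition Inj P Q : {set gmap P Q} :=
  [set f : gmap P Q |
    [forall x, forall y, f (x * y) == f x * f y] && injectiveb f].

Definition Iso P Q : {set gmap P Q} :=
  [set f in Inj P Q | gimage f == Q].

(* As s ranges over S, left and right conjugation by s give the same set. *)
Definition HomS P Q : {set gmap P Q} :=
  [set f : gmap P Q | [exists s : S, forall x, sgval (f x) == sgval x ^ s]].

(* The set Delta(U, alpha, V).  It does not depend on the codomain of alpha,
   so for phi : P -> Q, [Delta phi] is also Delta(phi(P), phi, P). *)
Definition Delta V U (alpha : gmap V U) : {set S * S} :=
  [set (sgval (alpha v), sgval v) | v : [subg V]].

Definition DeltaSS : {set {set S * S}} :=
  \bigcup_(U : {group S}) \bigcup_(V : {group S})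
    [set Delta alpha | alpha in Iso V U].

Definition diagS : {set S * S} := [set (s, s) | s : S].

Definition star (L M : {set S * S}) : {set S * S} :=
  [set gk | [exists h, ((gk.1, h) \in L) && ((h, gk.2) \in M)]].

Definition opp (L : {set S * S}) : {set S * S} := [set (gh.2, gh.1) | gh in L].

End Maps.

(* Candidate hom-sets of a category on the subgroups of S whose morphisms are
   maps; composition is always [gcomp]. *)
Definition homs (S : finGroupType) := forall P Q : {group S}, {set gmap P Q}.

Record fusion_system (S : finGroupType) (F : homs S) : Prop := FusionSystem {
  fus_id : forall P, gid P \in F P P;
  fus_comp : forall P Q R (g : gmap Q R) (f : gmap P Q),
    g \in F Q R -> f \in F P Q -> gcomp g f \in F P R;
  fus_HomS : forall P Q, HomS P Q \subset F P Q;
  fus_Inj : forall P Q, F P Q \subset Inj P Q;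
  (* psi is phi with codomain restricted to U = phi(P), chi its inverse *)
  fus_iso : forall P Q (phi : gmap P Q), phi \in F P Q ->
    exists (U : {group S}) (psi : gmap P U) (chi : gmap U P),
      [/\ gimage phi = U, forall x, sgval (psi x) = sgval (phi x),
          cancel psi chi, cancel chi psi
        & psi \in F P U /\ chi \in F U P]
}.

(* The subcategory relation; the objects are the same. *)
Definition subsystem (S : finGroupType) (F G : homs S) : Prop :=
  forall P Q, F P Q \subset G P Q.

Record delta_system (S : finGroupType) (X : {set {set S * S}}) : Prop :=
  DeltaSystem {
  sys_sub : X \subset DeltaSS S;
  sys_conj : forall L (x : S * S), L \in X -> L :^ x \in X;
  sys_subgroup : forall L (M : {group S * S}),
    L \in X -> M \subset L -> gval M \in X;
  sys_star : forall L M, L \in X -> M \in X -> star L M \in X;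
  sys_diag : diagS S \in X;
  sys_opp : [set opp L | L in X] = X
}.

Definition sys_of_fus (S : finGroupType) (F : homs S) : {set {set S * S}} :=
  \bigcup_(P : {group S}) [set Delta phi | phi in F P [set: S]%G].

Definition fus_of_sys (S : finGroupType) (X : {set {set S * S}}) : homs S :=
  fun P Q => \bigcup_(U : {group S} | U \subset Q)
    [set gcomp (incl U Q) phi | phi in Iso P U & Delta phi \in X].

(* Main.v *)
(* A map f : P -> Q and its twisted graph Delta(f) determine each other up to
   the codomain.  Since a fusion system contains all inclusions and allows any
   morphism to be corestricted to its image, membership of f in Hom_F(P, Q) is
   insensitive to the codomain, so that it is equivalent to Delta(f) being in
   S(F); dually, an injective homomorphism f lies in F(S) exactly when Delta(f)
   is in S.  Under this dictionary composition is *, inversion is opp,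
   restriction is passing to subgroups of Delta(f), and composing with
   S-conjugations on both sides is (S x S)-conjugation. *)
Require Import Defs.
From Stdlib Require Import FunctionalExtensionality.
From mathcomp Require Import all_boot all_fingroup all_solvable.

Set Implicit Arguments.
Unset Strict Implicit.
Unset Printing Implicit Defensive.

Import GroupScope.

(** * Injective maps between subgroups: corestriction and inverses *)

Section SubgroupMaps.
Variable S : finGroupType.
Implicit Types (P Q R U V : {group S}) (L M : {set S * S}).

Lemma pair_conjg (u v a b : S) :
  (u, v) ^ ((a, b) : S * S) = (u ^ a, v ^ b).
Proof. by []. Qed.

Lemma gmap_eq P Q (f g : gmap P Q) :
  (forall x, sgval (f x) = sgval (g x)) -> f = g.
Proof. by move=> eq_fg; apply/ffunP=> x; apply: val_inj; apply: eq_fg. Qed.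

Lemma InjP P Q (f : gmap P Q) :
  reflect ({morph f : x y / x * y} /\ injective f) (f \in Inj P Q).
Proof.
rewrite inE; apply: (iffP andP) => -[fM f_inj]; split.
- by move=> x y; apply/eqP; move/forallP/(_ x)/forallP: fM; apply.
- exact/injectiveP.
- by apply/forallP=> x; apply/forallP=> y; rewrite fM.
- exact/injectiveP.
Qed.

Lemma Inj_eq_val P Q R (f : gmap P Q) (g : gmap P R) :
  (forall x, sgval (g x) = sgval (f x)) -> f \in Inj P Q -> g \in Inj P R.
Proof.
move=> eq_gf /InjP[fM f_inj]; apply/InjP; split=> [x y | x y /(congr1 sgval)].
  by apply: val_inj; rewrite /= !eq_gf fM.
by rewrite !eq_gf => /val_inj/f_inj.
Qed.

Lemma gimageP P Q (f : gmap P Q) u :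
  reflect (exists x, u = sgval (f x)) (u \in gimage f).
Proof.
by apply: (iffP imsetP) => [[x _ ->] | [x ->]]; exists x.
Qed.

Lemma gmap_morph1 P Q (f : gmap P Q) : {morph f : x y / x * y} -> f 1 = 1.
Proof. by move=> fM; apply: (mulgI (f 1)); rewrite -fM !mulg1. Qed.

Lemma group_set_gimage P Q (f : gmap P Q) :
  f \in Inj P Q -> group_set (gimage f).
Proof.
case/InjP=> fM _; apply/group_setP; split.
  by apply/gimageP; exists 1; rewrite (gmap_morph1 fM).
move=> _ _ /gimageP[x ->] /gimageP[y ->].
by apply/gimageP; exists (x * y); rewrite fM.
Qed.

(* The map from [P] to [Q] with the values of [h]; only meaningful when [h]
   maps [P] into [Q], since [subg Q] is 1 outside [Q]. *)
Definition gmap_of P Q (h : S -> S) : gmap P Q :=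
  [ffun x => subg Q (h (sgval x))].

Lemma gmap_ofE P Q (h : S -> S) (x : [subg P]) :
  {in P, forall v, h v \in Q} -> sgval (gmap_of P Q h x) = h (sgval x).
Proof. by move=> hPQ; rewrite ffunE subgK ?hPQ ?subgP. Qed.

(** Working on raw elements of [S] makes maps with different domain and codomain types comparable.
    Outside [P] the value is that of [f] at 1. *)
Definition gval_fun P Q (f : gmap P Q) v := sgval (f (subg P v)).

Lemma gval_funE P Q (f : gmap P Q) x : gval_fun f (sgval x) = sgval (f x).
Proof. by rewrite /gval_fun sgvalK. Qed.

Lemma inclE P Q x : P \subset Q -> sgval (incl P Q x) = sgval x.
Proof. by move/subsetP=> sPQ; rewrite ffunE subgK ?sPQ ?subgP. Qed.

Lemma incl_compE P U Q (f : gmap P U) x :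
  U \subset Q -> sgval (gcomp (incl U Q) f x) = sgval (f x).
Proof. by move=> sUQ; rewrite ffunE inclE. Qed.

(** Bridges [Inj] and [Iso]: fusion systems are described by injective maps, whereas [DeltaSS] and
    [fus_of_sys] quantify over isomorphisms onto a subgroup. *)
Lemma corestriction P Q (f : gmap P Q) : f \in Inj P Q ->
  exists (U : {group S}) (g : gmap P U),
    [/\ gimage f = U, U \subset Q, g \in Iso P U
      & forall x, sgval (g x) = sgval (f x)].
Proof.
move=> f_inj; pose U := Group (group_set_gimage f_inj).
have fU v : v \in P -> gval_fun f v \in U by move=> _; apply/gimageP; exists (subg P v).
have gE x : sgval (gmap_of P U (gval_fun f) x) = sgval (f x).
  by rewrite gmap_ofE // gval_funE.
exists U, (gmap_of P U (gval_fun f)); split=> //.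
  by apply/subsetP=> _ /gimageP[x ->]; apply: subgP.
rewrite inE (Inj_eq_val gE) //=; apply/eqP/setP=> u.
by apply/gimageP/gimageP=> -[x ->]; exists x.
Qed.

Lemma Iso_inverse P U (f : gmap P U) : f \in Iso P U ->
  exists g : gmap U P, [/\ cancel f g, cancel g f & g \in Inj U P].
Proof.
rewrite inE => /andP[/InjP[fM f_inj] /eqP imf].
have f_onto y : exists x, f x == y.
  have /gimageP[x yx]: sgval y \in gimage f by rewrite imf subgP.
  by exists x; apply/eqP/val_inj.
pose g : gmap U P := [ffun y => xchoose (f_onto y)].
have gK : cancel g f by move=> y; rewrite ffunE (eqP (xchooseP (f_onto y))).
exists g; split=> // [x|]; first by apply: f_inj; rewrite gK.
apply/InjP; split; last exact: can_inj gK.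
by move=> x y; apply: f_inj; rewrite fM !gK.
Qed.

(** * Twisted graphs and the operations on them *)

Lemma DeltaP P Q (f : gmap P Q) (z : S * S) :
  reflect (exists x, z = (sgval (f x), sgval x)) (z \in Delta f).
Proof. by apply: (iffP imsetP) => [[x _ ->] | [x ->]]; exists x. Qed.

Lemma Delta_eq_val P Q R (f : gmap P Q) (g : gmap P R) :
  (forall x, sgval (g x) = sgval (f x)) -> Delta g = Delta f.
Proof. by move=> eq_gf; apply: eq_imset => x; rewrite eq_gf. Qed.

Lemma group_set_Delta P Q (f : gmap P Q) :
  {morph f : x y / x * y} -> group_set (Delta f).
Proof.
move=> fM; apply/group_setP; split.
  by apply/DeltaP; exists 1; rewrite (gmap_morph1 fM).
move=> _ _ /DeltaP[x ->] /DeltaP[y ->].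
by apply/DeltaP; exists (x * y); rewrite fM.
Qed.

(** The second coordinates of a graph recover its domain, and each of them occurs once, so the
    values are recovered too. They are compared in [S] because [Q] and [Q'] may differ. *)
Lemma Delta_inj P P' Q Q' (f : gmap P Q) (g : gmap P' Q') :
  Delta f = Delta g ->
  P = P' /\ {in P, gval_fun f =1 gval_fun g}.
Proof.
move=> eq_fg.
have fg x : exists y, (sgval (f x), sgval x) = (sgval (g y), sgval y).
  by apply/DeltaP; rewrite -eq_fg; apply/DeltaP; exists x.
have gf y : exists x, (sgval (g y), sgval y) = (sgval (f x), sgval x).
  by apply/DeltaP; rewrite eq_fg; apply/DeltaP; exists y.
split; last first.
  move=> v Pv; have [y [fy vy]] := fg (subg P v).
  by rewrite subgK // in vy; rewrite /gval_fun fy vy sgvalK.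
apply/group_inj/setP=> v; apply/idP/idP=> Gv.
  by have [y [_]] := fg (subg P v); rewrite subgK // => ->; apply: subgP.
by have [y [_]] := gf (subg P' v); rewrite subgK // => ->; apply: subgP.
Qed.

Lemma Delta_gcomp P Q R (g : gmap Q R) (f : gmap P Q) :
  Delta (gcomp g f) = star (Delta g) (Delta f).
Proof.
apply/setP=> -[a c]; rewrite inE /=; apply/DeltaP/existsP.
  case=> x [-> ->]; exists (sgval (f x)); rewrite ffunE.
  by apply/andP; split; apply/DeltaP; [exists (f x) | exists x].
case=> b /andP[/DeltaP[y [-> ->]] /DeltaP[x [/val_inj-> ->]]].
by exists x; rewrite ffunE.
Qed.

Lemma Delta_opp P Q (f : gmap P Q) (g : gmap Q P) :
  cancel f g -> cancel g f -> Defs.opp (Delta f) = Delta g.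
Proof.
move=> fK gK; apply/setP=> z; apply/imsetP/DeltaP.
  by case=> _ /DeltaP[x ->] ->; exists (f x); rewrite fK.
case=> y ->; exists (sgval (f (g y)), sgval (g y)); last by rewrite /= gK.
by apply/DeltaP; exists (g y).
Qed.

Lemma opp_involutive : involutive (@Defs.opp S).
Proof.
move=> L; rewrite /Defs.opp -imset_comp -[RHS]imset_id.
by apply: eq_imset => -[].
Qed.

Lemma Delta_DeltaSS P Q (f : gmap P Q) : f \in Inj P Q -> Delta f \in DeltaSS S.
Proof.
case/corestriction=> U [g [_ _ gIso eq_gf]].
apply/bigcupP; exists U => //; apply/bigcupP; exists P => //.
by apply/imsetP; exists g; rewrite ?(Delta_eq_val eq_gf).
Qed.

(** Enlarging the codomain to all of [S] leaves the graph unchanged and gives the normal form used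
    by [sys_of_fus]. *)
Lemma DeltaSSP L : L \in DeltaSS S ->
  exists (P : {group S}) (f : gmap P [set: S]%G),
    f \in Inj P [set: S]%G /\ L = Delta f.
Proof.
case/bigcupP=> U _ /bigcupP[V _ /imsetP[a]]; rewrite inE => /andP[aInj _] ->.
have fE x := incl_compE a x (subsetT U).
exists V, (gcomp (incl U [set: S]%G) a); split; first exact: Inj_eq_val fE aInj.
by rewrite (Delta_eq_val fE).
Qed.

Lemma HomS_Inj P Q : HomS P Q \subset Inj P Q.
Proof.
apply/subsetP=> f; rewrite inE => /existsP[s /forallP fJ].
apply/InjP; split=> [x y | x y /(congr1 sgval)].
  by apply: val_inj; rewrite /= (eqP (fJ _)) !(eqP (fJ _)) conjMg.
by rewrite !(eqP (fJ _)) => /conjg_inj/val_inj.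
Qed.

End SubgroupMaps.

(** * From fusion systems to systems of twisted diagonal subgroups *)

Section SysOfFus.
Variables (S : finGroupType) (F : homs S).
Hypothesis fusF : fusion_system F.
Implicit Types (P Q R U V : {group S}) (L M : {set S * S}).

Lemma fus_incl P Q : P \subset Q -> incl P Q \in F P Q.
Proof.
move=> sPQ; apply: (subsetP (fus_HomS fusF P Q)).
by rewrite inE; apply/existsP; exists 1; apply/forallP=> x; rewrite inclE // conjg1.
Qed.

Lemma fus_conj P Q s : {in P, forall v, v ^ s \in Q} ->
  gmap_of P Q (conjg^~ s) \in F P Q.
Proof.
move=> sPQ; apply: (subsetP (fus_HomS fusF P Q)).
by rewrite inE; apply/existsP; exists s; apply/forallP=> x; rewrite gmap_ofE.
Qed.

(** Membership ignores the codomain: corestrict [f] to its image, which lies in [R] because [g] has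
    the same values, then compose with the inclusion into [R]. *)
Lemma fus_eq_val P Q R (f : gmap P Q) (g : gmap P R) :
  (forall x, sgval (g x) = sgval (f x)) -> f \in F P Q -> g \in F P R.
Proof.
move=> eq_gf /(fus_iso fusF)[U [psi [chi [imf psiE _ _ [psiF _]]]]].
have sUR : U \subset R.
  by rewrite -imf; apply/subsetP=> _ /gimageP[x ->]; rewrite -eq_gf subgP.
rewrite (_ : g = gcomp (incl U R) psi).
  exact (fus_comp fusF (fus_incl sUR) psiF).
by apply: gmap_eq => x; rewrite incl_compE // psiE.
Qed.

Lemma sys_of_fusP L :
  reflect (exists (P : {group S}) (f : gmap P [set: S]%G),
             f \in F P [set: S]%G /\ L = Delta f)
          (L \in sys_of_fus F).
Proof.
apply: (iffP bigcupP) => [[P _ LP] | [P [f [fF ->]]]].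
  by have [f fF ->] := imsetP LP; exists P, f.
by exists P => //; apply/imsetP; exists f.
Qed.

Lemma mem_Delta_sys_of_fus P Q (f : gmap P Q) :
  (Delta f \in sys_of_fus F) = (f \in F P Q).
Proof.
apply/sys_of_fusP/idP=> [[P' [g [gF eqD]]] | fF]; last first.
  have hE x := incl_compE f x (subsetT Q).
  exists P, (gcomp (incl Q [set: S]%G) f); split; first exact: fus_eq_val hE fF.
  by rewrite (Delta_eq_val hE).
(* The domain is part of the type of [g], so the two domains are identified before the maps are
   compared. *)
have [eqPP fg] := Delta_inj eqD; move: eqPP g gF fg {eqD} => <- g gF fg.
by apply: fus_eq_val gF => x; rewrite -!gval_funE fg ?subgP.
Qed.

(** Conjugating [Delta f] by [(a, b)] gives the graph of the map sending [v] in [P :^ b] to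
    [f (v ^ b^-1) ^ a], a composite of [f] with two conjugations. *)
Lemma sys_of_fus_conj L (x : S * S) :
  L \in sys_of_fus F -> L :^ x \in sys_of_fus F.
Proof.
case: x => a b /sys_of_fusP[P [f [fF ->]]]; apply/sys_of_fusP.
have JP v : v \in (P :^ b)%G -> v ^ b^-1 \in P by rewrite mem_conjg.
have JT v : v \in [set: S]%G -> v ^ a \in [set: S]%G by rewrite !inE.
pose cb := gmap_of (P :^ b)%G P (conjg^~ b^-1).
pose ca := gmap_of [set: S]%G [set: S]%G (conjg^~ a).
exists (P :^ b)%G, (gcomp ca (gcomp f cb)); split.
  exact (fus_comp fusF (fus_conj JT) (fus_comp fusF fF (fus_conj JP))).
have caE x : sgval (ca x) = sgval x ^ a := gmap_ofE x JT.
have cbE x : sgval (cb x) = sgval x ^ b^-1 := gmap_ofE x JP.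
apply/setP=> z; apply/imsetP/DeltaP.
  case=> _ /DeltaP[x ->] ->.
  have Px : sgval x ^ b \in (P :^ b)%G by rewrite memJ_conjg subgP.
  pose y := subg (P :^ b)%G (sgval x ^ b).
  have yE : sgval y = sgval x ^ b by rewrite subgK.
  have cby : cb y = x by apply: val_inj; rewrite /= cbE yE conjgK.
  by exists y; rewrite pair_conjg ffunE caE ffunE cby yE.
case=> y ->; exists (sgval (f (cb y)), sgval (cb y)).
  by apply/DeltaP; exists (cb y).
by rewrite pair_conjg cbE conjgKV ffunE caE ffunE.
Qed.

Lemma sys_of_fus_subgroup L (M : {group S * S}) :
  L \in sys_of_fus F -> M \subset L -> gval M \in sys_of_fus F.
Proof.
case/sys_of_fusP=> P [f [fF ->]] /subsetP sML; apply/sys_of_fusP.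
(* [M] is the graph of the restriction of [f] to the second projection of [M]. *)
pose P' := (snd_morphism S S @* M)%G.
have P'P v : v \in P' -> exists2 x, v = sgval x & (sgval (f x), v) \in M.
  case/morphimP=> -[u w] _ Mz /= ->; have /DeltaP[x [eu ew]] := sML _ Mz.
  by exists x; rewrite // -eu.
have sP'P : P' \subset P by apply/subsetP=> v /P'P[x ->]; rewrite subgP.
exists P', (gcomp f (incl P' P)); split.
  exact (fus_comp fusF fF (fus_incl sP'P)).
apply/setP=> z; apply/idP/DeltaP=> [Mz | [y ->]].
  have /DeltaP[x zE] := sML _ Mz.
  have P'x : sgval x \in P' by apply/morphimP; exists z; rewrite ?inE //= zE.
  by exists (subg P' (sgval x)); rewrite !ffunE subgK // sgvalK.
by have [x yx] := P'P _ (subgP y); rewrite !ffunE yx sgvalK.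
Qed.

(** [Delta_gcomp] does not apply directly, since [g] takes values in [S] and [f] is defined on [P]
    only. The product is the graph of the composite on the subgroup [Q'] of those elements of [Q]
    that [g] sends into [P]. *)
Lemma sys_of_fus_star L M :
  L \in sys_of_fus F -> M \in sys_of_fus F -> star L M \in sys_of_fus F.
Proof.
case/sys_of_fusP=> P [f [fF ->]] /sys_of_fusP[Q [g [gF ->]]].
have /InjP[gM _] := subsetP (fus_Inj fusF _ _) _ gF.
have gQM : {in Q &, {morph gval_fun g : u v / u * v}}.
  move=> u v Qu Qv; rewrite /gval_fun.
  rewrite (_ : subg Q (u * v) = subg Q u * subg Q v) ?gM //.
  by apply: val_inj; rewrite /= !subgK ?groupM.
(* As a morphism on [Q], [g] has a preimage of [P] that is a group. *)
pose gm := Morphism gQM.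
pose Q' := (gm @*^-1 P)%G.
have Q'E v : v \in Q' -> v \in Q /\ gval_fun g v \in P.
  by case/morphpreP.
have sQ'Q : Q' \subset Q by apply/subsetP=> v /Q'E[].
have gQ'P : {in Q', forall v, gval_fun g v \in P} by move=> v /Q'E[].
pose h := gmap_of Q' P (gval_fun g).
have hE x : sgval (h x) = gval_fun g (sgval x) by apply: gmap_ofE.
have hF : h \in F Q' P.
  apply: (@fus_eq_val _ _ _ (gcomp g (incl Q' Q))).
    by move=> x; rewrite hE ffunE -gval_funE inclE.
  exact (fus_comp fusF gF (fus_incl sQ'Q)).
apply/sys_of_fusP; exists Q', (gcomp f h); split; first exact (fus_comp fusF fF hF).
(* Replacing [g] by its restriction [h] does not change the product: a middle element [b] belongs to
   [P], and over such [b] the two graphs agree. *)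
rewrite Delta_gcomp; apply/setP=> -[a c]; rewrite !inE /=.
apply: eq_existsb => b; apply: andb_id2l => /DeltaP[y [_ by_]].
apply/DeltaP/DeltaP=> -[x [bx ->]]; last first.
  have [Qx _] := Q'E _ (subgP x).
  by exists (subg Q (sgval x)); rewrite subgK // bx hE.
have Q'x : sgval x \in Q'.
  by apply/morphpreP; rewrite ?subgP //= gval_funE -bx by_ subgP.
by exists (subg Q' (sgval x)); rewrite hE subgK // gval_funE bx.
Qed.

(** The opposite graph belongs to the inverse of the corestriction of [f]; its codomain is [P]
    instead of [S], which [mem_Delta_sys_of_fus] allows. *)
Lemma sys_of_fus_opp L : L \in sys_of_fus F -> Defs.opp L \in sys_of_fus F.
Proof.
case/sys_of_fusP=> P [f [/(fus_iso fusF)[U [g [h [_ gE gK hK [_ hF]]]]] ->]].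
by rewrite -(Delta_eq_val gE) (Delta_opp gK hK) mem_Delta_sys_of_fus.
Qed.

Lemma delta_system_sys_of_fus : delta_system (sys_of_fus F).
Proof.
split.
- apply/subsetP=> _ /sys_of_fusP[P [f [fF ->]]].
  exact: Delta_DeltaSS (subsetP (fus_Inj fusF _ _) _ fF).
- exact: sys_of_fus_conj.
- exact: sys_of_fus_subgroup.
- exact: sys_of_fus_star.
- apply/sys_of_fusP; exists [set: S]%G, (gid [set: S]%G).
  split; first exact: fus_id.
  apply/setP=> z; apply/imsetP/DeltaP=> [[s _ ->] | [x ->]].
    by exists (subg [set: S]%G s); rewrite ffunE subgK ?inE.
  by exists (sgval x); rewrite ?ffunE.
- apply/setP=> L; apply/imsetP/idP=> [[M /sys_of_fus_opp ? ->] // | LF].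
  by exists (Defs.opp L); rewrite ?opp_involutive ?sys_of_fus_opp.
Qed.

End SysOfFus.

(** * The two constructions are mutually inverse *)

Lemma mem_fus_of_sys (S : finGroupType) (X : {set {set S * S}})
    (P Q : {group S}) (f : gmap P Q) :
  (f \in fus_of_sys X P Q) = (f \in Inj P Q) && (Delta f \in X).
Proof.
apply/bigcupP/andP=> [[U sUQ /imsetP[g]] | [fInj fX]].
  rewrite inE => /andP[]; rewrite inE => /andP[gInj _] gX ->.
  have fE x := incl_compE g x sUQ.
  by rewrite (Delta_eq_val fE); split; first exact: Inj_eq_val fE gInj.
have [U [g [_ sUQ gIso gE]]] := corestriction fInj.
exists U => //; apply/imsetP; exists g.
  by rewrite inE gIso (Delta_eq_val gE).
by apply: gmap_eq => x; rewrite incl_compE.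
Qed.

Lemma fus_of_sysK (S : finGroupType) (X : {set {set S * S}}) :
  X \subset DeltaSS S -> sys_of_fus (fus_of_sys X) = X.
Proof.
move=> sX; apply/setP=> L; apply/sys_of_fusP/idP=> [[P [f [fX ->]]] | LX].
  by move: fX; rewrite mem_fus_of_sys => /andP[].
have [P [f [fInj eqL]]] := DeltaSSP (subsetP sX L LX).
by exists P, f; rewrite mem_fus_of_sys fInj -eqL.
Qed.

Lemma sys_of_fusK (S : finGroupType) (F : homs S) :
  fusion_system F -> fus_of_sys (sys_of_fus F) = F.
Proof.
(* Families of hom-sets are functions of [P] and [Q], so their equality is reduced to that of the
   finite sets at each pair. *)
move=> fusF; do 2!apply: functional_extensionality_dep => ?.
apply/setP=> f; rewrite mem_fus_of_sys mem_Delta_sys_of_fus //.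
exact/andb_idl/subsetP/fus_Inj.
Qed.

(** * From systems of twisted diagonal subgroups to fusion systems *)

Section FusOfSys.
Variables (S : finGroupType) (X : {set {set S * S}}).
Hypothesis sysX : delta_system X.
Implicit Types P Q R U V : {group S}.

Lemma HomS_fus_of_sys P Q : HomS P Q \subset fus_of_sys X P Q.
Proof.
apply/subsetP=> f fJ; have fInj := subsetP (HomS_Inj P Q) _ fJ.
have /InjP[fM _] := fInj; rewrite mem_fus_of_sys fInj /=.
move: fJ; rewrite inE => /existsP[s /forallP fJ].
(* Conjugating [diagS S] by [(s, 1)] gives all pairs [(v ^ s, v)]; [Delta f] is the subgroup of
   those with [v] in [P]. *)
have /(sys_subgroup sysX (M := Group (group_set_Delta fM))) :=
  sys_conj sysX (s, 1) (sys_diag sysX).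
apply; apply/subsetP=> _ /DeltaP[x ->]; apply/imsetP.
exists (sgval x, sgval x); first by apply/imsetP; exists (sgval x).
by rewrite pair_conjg conjg1 (eqP (fJ x)).
Qed.

Lemma sys_opp_mem L : L \in X -> Defs.opp L \in X.
Proof. by move=> LX; rewrite -(sys_opp sysX); apply/imsetP; exists L. Qed.

Lemma fusion_system_fus_of_sys : fusion_system (fus_of_sys X).
Proof.
split.
- move=> P; apply: (subsetP (HomS_fus_of_sys P P)).
  by rewrite inE; apply/existsP; exists 1; apply/forallP=> x; rewrite ffunE conjg1.
- move=> P Q R g f; rewrite !mem_fus_of_sys Delta_gcomp.
  move=> /andP[/InjP[gM gI] gX] /andP[/InjP[fM fI] fX].
  rewrite (sys_star sysX) // andbT; apply/InjP; split=> [x y | x y].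
    by rewrite !ffunE fM gM.
  by rewrite !ffunE => /gI/fI.
- exact: HomS_fus_of_sys.
- by move=> P Q; apply/subsetP=> f; rewrite mem_fus_of_sys => /andP[].
move=> P Q f; rewrite mem_fus_of_sys => /andP[fInj fX].
have [U [g [imf _ gIso gE]]] := corestriction fInj.
have [h [gK hK hInj]] := Iso_inverse gIso.
(* The corestriction [g] has the same graph as [f], and its inverse [h] has the opposite graph. *)
have gX : Delta g \in X by rewrite (Delta_eq_val gE).
exists U, g, h; split=> //; rewrite !mem_fus_of_sys gX hInj.
by rewrite -(Delta_opp gK hK) sys_opp_mem // (Inj_eq_val gE).
Qed.

End FusOfSys.

Theorem theorem7p3 (p : nat) (S : finGroupType)
    (p_prime : prime p) (S_pgroup : p.-group [set: S]) :
  (forall F : homs S, fusion_system F -> delta_system (sys_of_fus F)) /\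
  (forall X : {set {set S * S}},
     delta_system X -> fusion_system (fus_of_sys X)) /\
  (forall F : homs S, fusion_system F -> fus_of_sys (sys_of_fus F) = F) /\
  (forall X : {set {set S * S}},
     delta_system X -> sys_of_fus (fus_of_sys X) = X) /\
  (forall F G : homs S, fusion_system F -> fusion_system G ->
     (subsystem F G <-> sys_of_fus F \subset sys_of_fus G)) /\
  (forall X Y : {set {set S * S}}, delta_system X -> delta_system Y ->
     (X \subset Y <-> subsystem (fus_of_sys X) (fus_of_sys Y))).
Proof.
split; first exact: delta_system_sys_of_fus.
split; first exact: fusion_system_fus_of_sys.
split; first exact: sys_of_fusK.
split=> [X sysX|]; first exact/fus_of_sysK/sys_sub.
split=> [F G fusF fusG | X Y sysX sysY]; split=> [sFG | sFG].
- apply/subsetP=> _ /sys_of_fusP[P [f [fF ->]]].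
  by rewrite mem_Delta_sys_of_fus // (subsetP (sFG _ _)).
- move=> P Q; apply/subsetP=> f; rewrite -!mem_Delta_sys_of_fus //.
  exact: (subsetP sFG).
- move=> P Q; apply/subsetP=> f; rewrite !mem_fus_of_sys => /andP[-> /=].
  exact: (subsetP sFG).
(* With both sets rewritten as images under [sys_of_fus], an element of [X] is the graph of a
   morphism, to which [sFG] applies. *)
rewrite -(fus_of_sysK (sys_sub sysX)) -(fus_of_sysK (sys_sub sysY)).
apply/subsetP=> _ /sys_of_fusP[P [f [fX ->]]]; apply/sys_of_fusP.
by exists P, f; rewrite (subsetP (sFG _ _)).
Qed.
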